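(* Let $2\le r_1<r_2$ be integers, let $T=[h,q_1,q_2]\in\mathfrak{F}(n)$ with $q_1\ge3$, and let $T'=[h,q_1-1,q_2+1]$. Then $\rho(T)>\rho(T')$.
   Context: $\rho(G)$ denotes the spectral radius (largest eigenvalue of the adjacency matrix) of a graph $G$. For integers $h,q_1,q_2\ge 2$ and fixed integers $2\le r_1<r_2$, the tree $[h,q_1,q_2]$ is constructed as follows: take a vertex $u$; attach to $u$ a pendant path with $h$ edges; attach to $u$ a path with $q_1$ edges ending at a vertex $v_1$, and attach to $v_1$ exactly $r_1$ pendant paths with $2$ edges each; attach to $u$ a path with $q_2$ edges ending at a vertex $v_2$, and attach to $v_2$ exactly $r_2$ pendant paths with $2$ edges each. It has $n=1+h+q_1+q_2+2(r_1+r_2)$ vertices. $\mathfrak{F}(n)$ is the set of all such trees $[h,q_1,q_2]$ with $h,q_1,q_2\ge2$ and $h+q_1+q_2=n-1-2(r_1+r_2)$. The tree $T'$ is obtained from $T$ by a 2-switch (removing two edges $ab,cd$ with $ac,bd$ non-edges and adding $ac,bd$), so it has the same degree sequence. *)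

(* Defs.v *)
From mathcomp Require Import all_boot all_order all_algebra.
From mathcomp Require Import polyrcf.
Set Implicit Arguments. Unset Strict Implicit. Unset Printing Implicit Defensive.
Import Order.TTheory GRing.Theory Num.Theory.
Local Open Scope ring_scope.

Definition adj_of_edges (R : nzRingType) (n : nat) (E : seq (nat * nat)) : 'M[R]_n :=
  \matrix_(i < n, j < n)
    (((nat_of_ord i, nat_of_ord j) \in E) || ((nat_of_ord j, nat_of_ord i) \in E))%:R.

Definition spectral_radius (R : rcfType) (n : nat) (A : 'M[R]_n) : R :=
  \big[Num.max/0]_(x <- rootsR (char_poly A)) x.

Definition tree_order (r1 r2 h q1 q2 : nat) : nat :=
  (1 + h + q1 + q2 + 2 * (r1 + r2))%N.

(* Edge list of the tree [h,q1,q2]: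
   u = 0;
   pendant path with h edges: 0 - 1 - ... - h;
   path with q1 edges: 0 - (h+1) - ... - (h+q1) = v1;
   path with q2 edges: 0 - (h+q1+1) - ... - (h+q1+q2) = v2;
   r1 pendant P_2's at v1: v1 - (b+2j) - (b+2j+1), j < r1, b = 1+h+q1+q2;
   r2 pendant P_2's at v2: v2 - (c+2j) - (c+2j+1), j < r2, c = b + 2 r1. *)
Definition tree_edges (r1 r2 h q1 q2 : nat) : seq (nat * nat) :=
  let v1 := (h + q1)%N in
  let v2 := (h + q1 + q2)%N in
  let b := (1 + h + q1 + q2)%N in
  let c := (b + 2 * r1)%N in
  [seq (i, i.+1) | i <- iota 0 h]
  ++ [seq ((if i == 0%N then 0%N else (h + i)%N), (h + i).+1) | i <- iota 0 q1]
  ++ [seq ((if i == 0%N then 0%N else (v1 + i)%N), (v1 + i).+1) | i <- iota 0 q2]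
  ++ flatten [seq [:: (v1, (b + 2 * j)%N); ((b + 2 * j)%N, (b + 2 * j).+1)] | j <- iota 0 r1]
  ++ flatten [seq [:: (v2, (c + 2 * j)%N); ((c + 2 * j)%N, (c + 2 * j).+1)] | j <- iota 0 r2].

Definition tree_adj (R : nzRingType) (n r1 r2 h q1 q2 : nat) : 'M[R]_n :=
  adj_of_edges R n (tree_edges r1 r2 h q1 q2).

(* Main.v *)
Require Import Defs.
From mathcomp Require Import all_boot all_order all_algebra.
From mathcomp Require Import polyrcf zify ring lra.
Import Order.TTheory GRing.Theory Num.Theory.
Local Open Scope ring_scope.

(** Eliminating vertices from the leaves towards the root [u] factors
    [det (x - A)] as the product of the pivots.  With [x = t + 1/t], [t > 1],
    the pivots along each branch are ratios of consecutive terms of sequences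
    [P t^k + Q t^-k], explicit in [t].  Let [t0 + 1/t0] be the spectral radius of
    the infinite broom at [v2].  For [t >= t0] all the pivots except the one at
    [u] are positive, and at [t0] the pivot of [T'] at [u] is negative, so
    [rho(T') > t0 + 1/t0] and the pivot of [T'] at [u] vanishes at [rho(T')].
    Writing [A], [C] for the sequences of the branches through [v1], [v2], the
    pivot of [T] at [u] then has the sign of
    [A q1.-1 * C q2.+1 - A q1 * C q2].  The vanishing of the pivot of [T'] bounds
    the growing part of [C] from above, while [v1] being weaker than [v2] bounds
    the growing part of [A] from below; together they make this difference
    negative, hence the characteristic polynomial of [T] is negative at [rho(T')]. *)

(** * Spectral radius as a root, and determinants of rooted trees *)

Lemma mem_rootsR (R : rcfType) (p : {poly R}) (x : R) :
  p != 0 -> (x \in rootsR p) = root p x.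
Proof. by move=> p0; rewrite -(roots_on_rootsR p0) inE. Qed.

Lemma horner_char_poly (R : comNzRingType) (n : nat) (A : 'M[R]_n) (x : R) :
  (char_poly A).[x] = \det (x%:M - A).
Proof.
rewrite /char_poly -horner_evalE -det_map_mx; congr (\det _).
apply/matrixP=> i j; rewrite !mxE /= /horner_eval !hornerE.
by rewrite hornerMn hornerX.
Qed.

(** A monic polynomial is positive from its Cauchy bound on, so a negative value at [x] forces a
    root to the right of [x]. *)
Lemma lt_spectral_radius (R : rcfType) (n : nat) (A : 'M[R]_n) (x : R) :
  (char_poly A).[x] < 0 -> x < spectral_radius A.
Proof.
set p := char_poly A => px.
have p_monic : p \is monic by apply: char_poly_monic.
have p0 : p != 0 by apply: monic_neq0.
have [y xy y_root] : exists2 y, x < y & root p y.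
  pose b := Num.max x (cauchy_bound p).
  have pb : 0 < p.[b].
    rewrite -sgr_gt0 (sgp_pinftyP (ge_cauchy_bound p0)); last first.
      by rewrite in_itv /= le_max lexx orbT.
    by rewrite /sgp_pinfty (monicP p_monic) sgr1.
  have xb : x <= b by rewrite le_max lexx.
  have [y] := @poly_ivtoo R p x b xb (etrans (pmulr_llt0 _ pb) px).
  by rewrite in_itv /= => /andP[xy _] yr; exists y.
apply: (lt_le_trans xy).
by rewrite /spectral_radius; apply: (le_bigmax_seq 0 y xpredT id); rewrite ?mem_rootsR.
Qed.

(** The maximum starts from the default [0]; positivity ensures that it is attained at a root. *)
Lemma root_spectral_radius (R : rcfType) (n : nat) (A : 'M[R]_n) :
  0 < spectral_radius A -> (char_poly A).[spectral_radius A] = 0.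
Proof.
move=> rho0; apply/rootP; rewrite -mem_rootsR ?monic_neq0 ?char_poly_monic //.
move: rho0; rewrite /spectral_radius.
elim: (rootsR _) => [|y s IHs]; first by rewrite big_nil ltxx.
by rewrite big_cons inE maxEle; case: ifP => _; rewrite ?eqxx // => /IHs->; rewrite orbT.
Qed.

(* With [L = 1 - N D^-1], where [N i j = 1] iff [(i, j)] is a (parent, child)
   edge and [D] is the diagonal matrix of the [D_i], one has [x - A = L D L^T]:
   the term [N D^-1 N^T] is diagonal because a child has only one parent. *)
Lemma det_rooted_tree (R : fieldType) (n : nat) (E : seq (nat * nat))
    (D : nat -> R) (x : R) :
  (forall e, e \in E -> (e.1 < e.2)%N) ->
  (forall e, e \in E -> (e.2 < n)%N) ->
  uniq [seq e.2 | e <- E] ->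
  (forall i, (0 < i < n)%N -> D i != 0) ->
  (forall i, (i < n)%N -> x = D i + \sum_(e <- E | e.1 == i) (D e.2)^-1) ->
  \det (x%:M - adj_of_edges R n E) = \prod_(i < n) D i.
Proof.
move=> Elt En Euniq D0 Dx.
have Einj a b c : (a, c) \in E -> (b, c) \in E -> a = b.
  elim: E Euniq {Elt En Dx} => // -[a' c'] E IHE /= /andP[Ec EU].
  have cE d : (d, c') \in E -> false.
    by move=> dE; move/mapP: Ec; case; exists (d, c').
  rewrite !inE !xpair_eqE => /orP[/andP[/eqP-> /eqP->]|aE] /orP[/andP[/eqP-> /eqP cc]|bE] //.
  - by have := cE _ bE.
  - by move: aE; rewrite cc => /cE.
  - exact: IHE.
pose N : 'M[R]_n := \matrix_(i, j) ((val i, val j) \in E)%:R.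
pose L : 'M[R]_n := \matrix_(i, j) ((i == j)%:R - N i j / D j).
pose DD : 'M[R]_n := diag_mx (\row_i D i).
have detL : \det L = 1.
  rewrite -det_tr det_trig; last first.
    apply/is_trig_mxP=> i j ij; rewrite !mxE.
    rewrite (negPf (_ : j != i)); last by rewrite -val_eqE /= gtn_eqF.
    case: (boolP (_ \in E)) => [/Elt /=|_]; last by rewrite mul0r subr0.
    by rewrite ltnNge ltnW.
  apply: big1 => i _; rewrite !mxE eqxx.
  case: (boolP (_ \in E)) => [/Elt /=|_]; last by rewrite mul0r subr0.
  by rewrite ltnn.
suff -> : x%:M - adj_of_edges R n E = L *m DD *m L^T.
  rewrite !det_mulmx det_tr detL mul1r mulr1 det_diag.
  by apply: eq_bigr => i _; rewrite mxE.
(* Nonzero entries of [N] lie in columns of children, so the root pivot [D 0] is allowed to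
   vanish. *)
have ND i j : N i j != 0 -> D j != 0.
  rewrite !mxE; case: (boolP (_ \in E)) => [/Elt /= ij _|_]; last by rewrite eqxx.
  by apply: D0; rewrite ltn_ord andbT (leq_ltn_trans _ ij).
apply/matrixP=> i j; rewrite mxE [RHS]mxE.
transitivity (\sum_k ((i == k)%:R * (j == k)%:R * D k - (i == k)%:R * N j k
     - (j == k)%:R * N i k + N i k * N j k / D k)); last first.
  apply: eq_bigr => k _; rewrite mul_mx_diag.
  have [Ni0|/ND Dk0] := eqVneq (N i k) 0.
    rewrite !mxE -/(N _ _).
    have [Nj0|/ND Dk0] := eqVneq (N j k) 0.
      by move: Ni0 Nj0; rewrite !mxE => -> ->; ring.
    move: Ni0; rewrite !mxE => ->; field; exact: Dk0.
  by rewrite !mxE; field; exact: Dk0.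
rewrite !big_split /= !sumrN.
rewrite [X in X - _ - _](bigD1 i) //= [X in _ + X - _ - _]big1 ?addr0; last first.
  by move=> k ki; rewrite eq_sym (negPf ki) !mul0r.
rewrite [X in _ - X - _](bigD1 i) //= [X in _ - (_ + X) - _]big1 ?addr0; last first.
  by move=> k ki; rewrite eq_sym (negPf ki) !mul0r.
rewrite [X in _ - _ - X](bigD1 j) //= [X in _ - _ - (_ + X)]big1 ?addr0; last first.
  by move=> k ki; rewrite eq_sym (negPf ki) !mul0r.
rewrite !eqxx !mul1r !mxE.
have NN : (((val i, val j) \in E) || ((val j, val i) \in E))%:R
    = ((val i, val j) \in E)%:R + ((val j, val i) \in E)%:R :> R.
  case: (boolP (_ \in E)) => [/Elt /= ij|_]; last by rewrite add0r.
  case: (boolP (_ \in E)) => [/Elt /= ji|_]; last by rewrite addr0.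
  by move: (ltn_trans ij ji); rewrite ltnn.
rewrite NN; have [<-|ij] := eqVneq i j; last first.
  rewrite big1; first by rewrite !mulr0n mul0r; ring.
  move=> k _; rewrite !mxE.
  case: (boolP (_ \in E)) => [ik|_]; last by rewrite !mul0r.
  case: (boolP (_ \in E)) => [jk|_]; last by rewrite mulr0 mul0r.
  by move: ij; rewrite -val_eqE (Einj _ _ _ ik jk) eqxx.
rewrite mulr1n mul1r (Dx i) //.
suff -> : \sum_(e <- E | e.1 == i) (D e.2)^-1 = \sum_k N i k * N i k / D k by ring.
transitivity (\sum_(e <- E | e.1 == i) \sum_(k < n | val k == e.2) (D k)^-1).
  rewrite big_seq_cond [RHS]big_seq_cond; apply: eq_bigr => e /andP[eE _].
  rewrite (big_pred1 (Ordinal (En _ eE))) //.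
rewrite (exchange_big_dep xpredT) //=; apply: eq_bigr => k _.
rewrite !mxE; case: (boolP (_ \in E)) => [ik|ikN].
  rewrite !mul1r big_const_seq.
  suff -> : count (fun e => (e.1 == val i) && (val k == e.2)) E = 1%N.
    by rewrite /= addr0.
  rewrite (eq_count (a2 := pred1 (val i, val k))).
    by rewrite count_uniq_mem ?ik // (map_uniq Euniq).
  by move=> [a b] /=; rewrite xpair_eqE [b == _]eq_sym.
rewrite !mul0r big_seq_cond big1 // => -[a b] /= /and3P[abE /eqP ai /eqP kb].
by case/negP: ikN; rewrite /= -[nat_of_ord i]ai kb.
Qed.

(** * The edge list and sums over children *)

(** The numbering makes each vertex other than [u] a child exactly once; uniqueness of parents and
    the bound on the indices both follow. *)
Lemma children_tree_edges (r1 r2 h q1 q2 : nat) :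
  [seq e.2 | e <- tree_edges r1 r2 h q1 q2] =
  iota 1 (tree_order r1 r2 h q1 q2).-1.
Proof.
have map_iota (f : nat -> nat) k m : (forall i, f i = (k + i)%N) ->
    [seq f i | i <- iota 0 m] = iota k m.
  by move=> fE; rewrite (eq_map fE) -iotaDl addn0.
have legs v k m : [seq e.2 | e <- flatten
    [seq [:: (v, (k + 2 * j)%N); ((k + 2 * j)%N, (k + 2 * j).+1)] | j <- iota 0 m]]
    = iota k (2 * m).
  elim: m => [|m IHm] //; rewrite -[m.+1]addn1 [iota 0 _]iotaD map_cat flatten_cat map_cat IHm.
  by rewrite mulnDr iotaD add0n.
have -> : (tree_order r1 r2 h q1 q2).-1 = (h + (q1 + (q2 + (2 * r1 + 2 * r2))))%N.
  by rewrite /tree_order; lia.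
rewrite /tree_edges !map_cat -!map_comp /= !legs.
rewrite (map_iota _ 1%N) //= (map_iota _ h.+1) // (map_iota _ (h + q1).+1) //.
by rewrite !iotaD; do ?[congr (_ ++ _)]; congr (iota _ _); lia.
Qed.

Lemma tree_edges_lt (r1 r2 h q1 q2 : nat) e : (0 < q1)%N -> (0 < q2)%N ->
  e \in tree_edges r1 r2 h q1 q2 -> (e.1 < e.2)%N.
Proof.
move=> q10 q20; rewrite !mem_cat => /or4P[||| /orP[]].
- by case/mapP=> i _ ->.
- by case/mapP=> i _ -> /=; case: ifP; lia.
- by case/mapP=> i _ -> /=; case: ifP; lia.
- by case/flatten_mapP=> j _; rewrite !inE => /orP[] /eqP-> /=; lia.
- by case/flatten_mapP=> j _; rewrite !inE => /orP[] /eqP-> /=; lia.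
Qed.

Lemma sum_iota_pred1 (R : nmodType) (m k i : nat) (f : nat -> nat) (F : nat -> R) :
  (k < m)%N -> (forall j, (j < m)%N -> (f j == i) = (j == k)) ->
  \sum_(j <- iota 0 m | f j == i) F j = F k.
Proof.
move=> km fP; rewrite big_seq_cond (eq_bigl (fun j => j == k)); last first.
  move=> j; rewrite mem_iota add0n /=; case: (ltnP j m) => [/fP-> //|mj].
  by apply/esym/negbTE; lia.
by rewrite -big_filter filter_pred1_uniq ?iota_uniq ?mem_iota // big_seq1.
Qed.

Lemma sum_iota_pred0 (R : nmodType) (m i : nat) (f : nat -> nat) (F : nat -> R) :
  (forall j, (j < m)%N -> f j != i) -> \sum_(j <- iota 0 m | f j == i) F j = 0.
Proof.
move=> fP; rewrite big_seq_cond big1 // => j; rewrite mem_iota => /andP[/fP].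
by move=> /negPf->.
Qed.

Lemma sum_tree_edges (R : nmodType) (r1 r2 h q1 q2 i : nat) (F : nat -> R) :
  let b := (1 + h + q1 + q2)%N in
  \sum_(e <- tree_edges r1 r2 h q1 q2 | e.1 == i) F e.2 =
    \sum_(j <- iota 0 h | j == i) F j.+1
  + (\sum_(j <- iota 0 q1 | (if j == 0 then 0 else h + j)%N == i) F (h + j).+1
  + (\sum_(j <- iota 0 q2 | (if j == 0 then 0 else h + q1 + j)%N == i)
       F (h + q1 + j).+1
  + ((if (h + q1)%N == i then \sum_(j <- iota 0 r1) F (b + 2 * j)%N else 0)
  + \sum_(j <- iota 0 r1 | (b + 2 * j)%N == i) F (b + 2 * j).+1
  + ((if (h + q1 + q2)%N == i then
        \sum_(j <- iota 0 r2) F (b + 2 * r1 + 2 * j)%N else 0)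
  + \sum_(j <- iota 0 r2 | (b + 2 * r1 + 2 * j)%N == i)
       F (b + 2 * r1 + 2 * j).+1)))).
Proof.
have legs v k m : \sum_(e <- flatten [seq [:: (v, (k + 2 * j)%N);
      ((k + 2 * j)%N, (k + 2 * j).+1)] | j <- iota 0 m] | e.1 == i) F e.2
    = (if v == i then \sum_(j <- iota 0 m) F (k + 2 * j)%N else 0)
      + \sum_(j <- iota 0 m | (k + 2 * j)%N == i) F (k + 2 * j).+1.
  rewrite big_flatten big_map.
  rewrite [X in _ + X]big_mkcond.
  have -> : (if v == i then \sum_(j <- iota 0 m) F (k + 2 * j)%N else 0)
      = \sum_(j <- iota 0 m) (if v == i then F (k + 2 * j)%N else 0).
    by case: ifP => // _; rewrite big1.
  rewrite -big_split; apply: eq_bigr => j _.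
  rewrite !big_cons big_nil /=.
  by do 2?case: ifP => _; rewrite ?addr0 ?add0r.
by rewrite /tree_edges !big_cat !big_map !legs.
Qed.

(** * Pivots and the characteristic polynomial of the tree *)

(** Writing pivots as [s k.+1 / s k] linearises the relation [d = x - 1/d'] between consecutive
    pivots on a path. *)
Definition linrec {R : nzRingType} (x : R) (s : nat -> R) : Prop :=
  forall k, s k.+2 = x * s k.+1 - s k.

(* The pivots of the elimination from the leaves; the sequence of a branch is
   indexed by the distance to its end ([E], shifted by one) or to [v1], [v2] ([A], [C]). *)
Definition elim_diag {R : fieldType} (h q1 q2 : nat) (x d0 : R)
    (E A C : nat -> R) (i : nat) : R :=
  if i == 0%N then d0
  else if (i <= h)%N then E (h - i).+2 / E (h - i).+1
  else if (i <= h + q1)%N then A (h + q1 - i).+1 / A (h + q1 - i)%N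
  else if (i <= h + q1 + q2)%N then
    C (h + q1 + q2 - i).+1 / C (h + q1 + q2 - i)%N
  else if odd (i - (1 + h + q1 + q2)) then x else (x ^+ 2 - 1) / x.

(** The initial values encode the ends of the branches: [E 0 = 0] gives the leaf pivot
    [E 2 / E 1 = x], and [A 1 / A 0 = x - r1 x / (x^2 - 1)] accounts for the [r1] legs at [v1];
    likewise [C] at [v2]. *)
Lemma elim_diagE (R : realFieldType) (r1 r2 h q1 q2 : nat) (x : R)
    (E A C : nat -> R) :
  (0 < h)%N -> (0 < q1)%N -> (0 < q2)%N -> 1 < x ->
  linrec x E -> linrec x A -> linrec x C ->
  E 0%N = 0 -> (forall k, 0 < E k.+1) -> (forall k, 0 < A k) -> (forall k, 0 < C k) ->
  A 0%N = x ^+ 2 - 1 -> A 1%N = x * (x ^+ 2 - 1 - r1%:R) ->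
  C 0%N = x ^+ 2 - 1 -> C 1%N = x * (x ^+ 2 - 1 - r2%:R) ->
  let d0 := x - E h / E h.+1 - A q1.-1 / A q1 - C q2.-1 / C q2 in
  let D := elim_diag h q1 q2 x d0 E A C in
  forall i, (i < tree_order r1 r2 h q1 q2)%N ->
  x = D i + \sum_(e <- tree_edges r1 r2 h q1 q2 | e.1 == i) (D e.2)^-1.
Proof.
move=> h0 q10 q20 x1 Erec Arec Crec E0 Epos Apos Cpos A0 A1 C0 C1 d0 D i.
have x0 : x != 0 by apply: lt0r_neq0; lra.
have w0 : x ^+ 2 - 1 != 0 by apply: lt0r_neq0; nra.
have EN k : E k.+1 != 0 by apply: lt0r_neq0.
have AN k : A k != 0 by apply: lt0r_neq0.
have CN k : C k != 0 by apply: lt0r_neq0.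
rewrite (sum_tree_edges _ _ _ _ _ _ _ (fun j => (D j)^-1)) => i_lt.
have DE j : (0 < j <= h)%N -> D j = E (h - j).+2 / E (h - j).+1.
  by move=> jP; rewrite /D /elim_diag; do ?case: ifP; try lia.
have DA j : (h < j <= h + q1)%N -> D j = A (h + q1 - j).+1 / A (h + q1 - j)%N.
  by move=> jP; rewrite /D /elim_diag; do ?case: ifP; try lia.
have DC j : (h + q1 < j <= h + q1 + q2)%N ->
    D j = C (h + q1 + q2 - j).+1 / C (h + q1 + q2 - j)%N.
  by move=> jP; rewrite /D /elim_diag; do ?case: ifP; try lia.
(* Even offsets are the middle vertices of the legs, with pivot [x - 1/x]; odd offsets are their
   leaves. *)
have Dp k : D (1 + h + q1 + q2 + 2 * k)%N = (x ^+ 2 - 1) / x.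
  by rewrite /D /elim_diag; do ?case: ifP; try lia.
have Dl k : D (1 + h + q1 + q2 + 2 * k).+1 = x.
  by rewrite /D /elim_diag; do ?case: ifP; try lia.
have Dp2 k : D (1 + h + q1 + q2 + 2 * r1 + 2 * k)%N = (x ^+ 2 - 1) / x.
  by rewrite -addnA -mulnDr Dp.
have Dl2 k : D (1 + h + q1 + q2 + 2 * r1 + 2 * k).+1 = x.
  by rewrite -addnA -mulnDr Dl.
have legs m k : (forall j, D (k + 2 * j)%N = (x ^+ 2 - 1) / x) ->
    \sum_(j <- iota 0 m) (D (k + 2 * j)%N)^-1 = m%:R * (x / (x ^+ 2 - 1)).
  move=> Dk; under eq_bigr do rewrite Dk invf_div.
  by rewrite big_const_seq count_predT size_iota iter_addr_0 mulr_natl.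
rewrite !legs //.
have ifN_eq (a b : nat) (y z : R) : a != b -> (if a == b then y else z) = z.
  by move/negPf->.
have [i0|i_neq0] := eqVneq i 0%N.
  subst i.
  rewrite (@sum_iota_pred1 _ h 0%N) // (@sum_iota_pred1 _ q1 0%N) //;
    last by move=> j _; case: ifP; lia.
  rewrite (@sum_iota_pred1 _ q2 0%N) //; last by move=> j _; case: ifP; lia.
  rewrite !ifN_eq ?sum_iota_pred0; try lia.
  rewrite !addn0 [D 1%N]DE; last lia.
  rewrite [D h.+1]DA; last lia.
  rewrite [D (h + q1).+1]DC; last lia.
  have -> : (h - 1 = h.-1)%N by lia.
  have -> : (h + q1 - h.+1 = q1.-1)%N by lia.
  have -> : (h + q1 + q2 - (h + q1).+1 = q2.-1)%N by lia.
  by rewrite !prednK // /D /elim_diag /= /d0 !invf_div; ring.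
(* Away from [u], a path contributes the inverse pivot of the next vertex, and nothing at its
   end. *)
have S1 : \sum_(j <- iota 0 h | j == i) (D j.+1)^-1
    = if (i < h)%N then (D i.+1)^-1 else 0.
  by case: ifP => ih; [rewrite (@sum_iota_pred1 _ h i) | rewrite sum_iota_pred0] => // j jh; lia.
have S2 : \sum_(j <- iota 0 q1 | (if j == 0 then 0 else h + j)%N == i) (D (h + j).+1)^-1
    = if (h < i < h + q1)%N then (D i.+1)^-1 else 0.
  case: ifP => ih; [rewrite (@sum_iota_pred1 _ q1 (i - h))|rewrite sum_iota_pred0] => //.
  - by rewrite subnKC //; lia.
  - by lia.
  - by move=> j jh; case: ifP; lia.
  - by move=> j jh; case: ifP; lia.
have S3 : \sum_(j <- iota 0 q2 | (if j == 0 then 0 else h + q1 + j)%N == i)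
    (D (h + q1 + j).+1)^-1 = if (h + q1 < i < h + q1 + q2)%N then (D i.+1)^-1 else 0.
  case: ifP => ih; [rewrite (@sum_iota_pred1 _ q2 (i - (h + q1)))|rewrite sum_iota_pred0] => //.
  - by rewrite subnKC //; lia.
  - by lia.
  - by move=> j jh; case: ifP; lia.
  - by move=> j jh; case: ifP; lia.
have Sleg k m : (forall j, D (k + 2 * j).+1 = x) ->
    \sum_(j <- iota 0 m | (k + 2 * j)%N == i) (D (k + 2 * j).+1)^-1
    = if (k <= i < k + 2 * m)%N && ~~ odd (i - k) then x^-1 else 0.
  move=> Dk; case: ifP => ik; last by rewrite sum_iota_pred0 // => j jm; lia.
  by rewrite (@sum_iota_pred1 _ m (i - k)./2) ?Dk // => [|j jm]; lia.
rewrite S1 S2 S3 !Sleg // {S1 S2 S3 Sleg}.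
have [ih|ih] := ltnP i h.
  do ![case: ifP => ?; try lia] => //.
  rewrite !DE; try lia.
  have -> : (h - i = (h - i.+1).+1)%N by lia.
  by rewrite Erec; field; rewrite !EN.
have [ih'|ih'] := eqVneq i h.
  do ![case: ifP => ?; try lia] => //.
  rewrite DE; last lia.
  by rewrite ih' subnn Erec E0; field; rewrite EN.
have [iv|iv] := ltnP i (h + q1).
  do ![case: ifP => ?; try lia] => //.
  rewrite !DA; try lia.
  have -> : (h + q1 - i = (h + q1 - i.+1).+1)%N by lia.
  by rewrite Arec; field; rewrite !AN.
have [iv'|iv'] := eqVneq i (h + q1)%N.
  do ![case: ifP => ?; try lia] => //.
  rewrite DA; last lia.
  by rewrite iv' subnn A0 A1; field; rewrite w0.
have [iw|iw] := ltnP i (h + q1 + q2).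
  do ![case: ifP => ?; try lia] => //.
  rewrite !DC; try lia.
  have -> : (h + q1 + q2 - i = (h + q1 + q2 - i.+1).+1)%N by lia.
  by rewrite Crec; field; rewrite !CN.
have [iw'|iw'] := eqVneq i (h + q1 + q2)%N.
  do ![case: ifP => ?; try lia] => //.
  rewrite DC; last lia.
  by rewrite iw' subnn C0 C1; field; rewrite w0.
have [k ik] : exists k, i = (1 + h + q1 + q2 + k)%N.
  by exists (i - (1 + h + q1 + q2))%N; lia.
have klt : (k < 2 * (r1 + r2))%N by move: i_lt; rewrite /tree_order; lia.
have [kodd|keven] := boolP (odd k).
  do ![case: ifP => ?; try lia] => //.
  have -> : i = (1 + h + q1 + q2 + 2 * k./2).+1 by lia.
  by rewrite Dl; ring.
have -> : D i = (x ^+ 2 - 1) / x.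
  have -> : i = (1 + h + q1 + q2 + 2 * k./2)%N by lia.
  by rewrite Dp.
by do ![case: ifP => ?; try lia] => //; field.
Qed.

(** The constant is the product of the pivots other than the one at [u], all positive here, so the
    sign is that of the pivot at [u]. *)
Lemma char_poly_tree (R : realFieldType) (r1 r2 h q1 q2 : nat) (x : R)
    (E A C : nat -> R) :
  (0 < h)%N -> (0 < q1)%N -> (0 < q2)%N -> 1 < x ->
  linrec x E -> linrec x A -> linrec x C ->
  E 0%N = 0 -> (forall k, 0 < E k.+1) -> (forall k, 0 < A k) -> (forall k, 0 < C k) ->
  A 0%N = x ^+ 2 - 1 -> A 1%N = x * (x ^+ 2 - 1 - r1%:R) ->
  C 0%N = x ^+ 2 - 1 -> C 1%N = x * (x ^+ 2 - 1 - r2%:R) ->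
  exists2 c, 0 < c &
    (char_poly (tree_adj R (tree_order r1 r2 h q1 q2) r1 r2 h q1 q2)).[x]
    = c * (x - E h / E h.+1 - A q1.-1 / A q1 - C q2.-1 / C q2).
Proof.
move=> h0 q10 q20 x1 Erec Arec Crec E0 Epos Apos Cpos A0 A1 C0 C1.
set d0 := _ - C _ / _.
pose D := elim_diag h q1 q2 x d0 E A C.
have Dpos i : (0 < i)%N -> 0 < D i.
  rewrite /D /elim_diag lt0n => /negPf->.
  do ![case: ifP => _]; rewrite ?divr_gt0 //; nra.
have n_gt0 : (0 < tree_order r1 r2 h q1 q2)%N by [].
exists (\prod_(i < tree_order r1 r2 h q1 q2 | i != Ordinal n_gt0) D i).
  by apply: prodr_gt0 => i i0; apply: Dpos; rewrite lt0n.
rewrite horner_char_poly (@det_rooted_tree _ _ _ D).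
- by rewrite (bigD1 (Ordinal n_gt0)) //= mulrC.
- by move=> e; apply: tree_edges_lt.
- move=> e /(map_f snd); rewrite children_tree_edges mem_iota.
  by rewrite add1n prednK // => /andP[].
- by rewrite children_tree_edges iota_uniq.
- by move=> i /andP[/Dpos/lt0r_neq0].
- exact: elim_diagE.
Qed.

(** * Explicit solutions of the recurrence *)

(** For [x = t + 1/t] the characteristic roots of the recurrence are [t] and [1/t]; if [t > 1], [P]
    weights the growing part and [Q] the decaying one. *)
Definition exp_pair {R : fieldType} (P Q t : R) (k : nat) : R := P * t ^+ k + Q / t ^+ k.

Lemma exp_pair_linrec (R : fieldType) (P Q t : R) : t != 0 -> linrec (t + t^-1) (exp_pair P Q t).
Proof.
move=> t0 k; have tk0 : t ^+ k != 0 by rewrite expf_neq0.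
by rewrite /exp_pair !exprS; field; rewrite t0 tk0.
Qed.

Lemma exp_pair_gt0 (R : realFieldType) (P Q t : R) k : 0 < t -> 0 <= P -> 0 < Q -> 0 < exp_pair P Q t k.
Proof.
move=> t0 P0 Q0; have tk : 0 < t ^+ k by rewrite exprn_gt0.
by apply: ltr_wpDl; [rewrite mulr_ge0 // ltW | rewrite divr_gt0].
Qed.

Lemma pendant_gt0 (R : realFieldType) (t : R) k : 1 < t -> 0 < exp_pair 1 (-1) t k.+1.
Proof.
move=> t1; have tk : 1 < t ^+ k.+1 by rewrite exprn_egt1.
have tk0 : 0 < t ^+ k.+1 by lra.
rewrite /exp_pair mul1r mulN1r subr_gt0 (lt_trans _ tk) // invf_lt1 //.
Qed.

(** The sequence of the pendant path is [t^k - t^-k]; a finite path contributes less at [u] than the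
    limit [1/t] of an infinite one. *)
Lemma pendant_ratio (R : realFieldType) (t : R) h : 1 < t -> (0 < h)%N ->
  0 < exp_pair 1 (-1) t h / exp_pair 1 (-1) t h.+1 < t^-1.
Proof.
case: h => // h t1 _; rewrite divr_gt0 ?pendant_gt0 //=.
rewrite ltr_pdivrMr ?pendant_gt0 // ltr_pdivlMl; last lra.
have tk : 0 < t ^+ h.+1 by rewrite exprn_gt0 //; lra.
rewrite /exp_pair [t ^+ h.+2]exprS; set u := t ^+ h.+1 in tk *.
have tu : (t * u)^-1 < t / u.
  rewrite ltr_pdivlMr // invfM -mulrA mulVf ?lt0r_neq0 // mulr1.
  by apply: lt_trans (t1); rewrite invf_lt1; lra.
have -> : t * (1 * u + -1 / u) = t * u - t / u by ring.
by rewrite mul1r mulN1r; lra.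
Qed.

(* Solving [s 0 = w], [s 1 = x (w - r)] with [x = t + 1/t], [w = x^2 - 1]. *)
Definition growing {R : fieldType} (r : nat) (t : R) : R :=
  let x := t + t^-1 in ((x ^+ 2 - 1) * t - r%:R * x) / (t - t^-1).
Definition decaying {R : fieldType} (r : nat) (t : R) : R :=
  let x := t + t^-1 in (r%:R * x - (x ^+ 2 - 1) / t) / (t - t^-1).
Definition branch {R : fieldType} (r : nat) (t : R) : nat -> R :=
  exp_pair (growing r t) (decaying r t) t.

Lemma branch0 (R : realFieldType) r (t : R) : 1 < t ->
  branch r t 0%N = (t + t^-1) ^+ 2 - 1.
Proof.
move=> t1; have t0 : t != 0 by apply: lt0r_neq0; lra.
have t2 : t * t - 1 != 0 by apply: lt0r_neq0; nra.
by rewrite /branch /exp_pair /growing /decaying; field; rewrite t0 t2.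
Qed.

Lemma branch1 (R : realFieldType) r (t : R) : 1 < t ->
  branch r t 1%N = (t + t^-1) * ((t + t^-1) ^+ 2 - 1 - r%:R).
Proof.
move=> t1; have t0 : t != 0 by apply: lt0r_neq0; lra.
have t2 : t * t - 1 != 0 by apply: lt0r_neq0; nra.
by rewrite /branch /exp_pair /growing /decaying; field; rewrite t0 t2.
Qed.

(** The sign is that of [u^2 + u + 1 - r (u + 1)], whose vanishing characterises the infinite broom
    with [r] legs. *)
Lemma growingE (R : realFieldType) r (t : R) : 1 < t -> let u := t ^+ 2 in
  growing r t = (u ^+ 2 + u + 1 - r%:R * (u + 1)) / (u - 1).
Proof.
move=> t1 u; have t0 : t != 0 by apply: lt0r_neq0; lra.
have t2 : t ^+ 2 - 1 != 0 by apply: lt0r_neq0; nra.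
by rewrite /growing /u; field; rewrite t2 t0.
Qed.

Lemma decayingE (R : realFieldType) r (t : R) : 1 < t -> let u := t ^+ 2 in
  decaying r t = (r%:R * (u + 1) - (u + 1 + u^-1)) / (u - 1).
Proof.
move=> t1 u; have t0 : t != 0 by apply: lt0r_neq0; lra.
have t2 : t ^+ 2 - 1 != 0 by apply: lt0r_neq0; nra.
by rewrite /decaying /u; field; rewrite t2 t0.
Qed.

(** * Inequalities between growing and decaying parts *)

Lemma decaying_gt0 (R : realFieldType) r (t : R) : 1 < t -> (2 <= r)%N -> 0 < decaying r t.
Proof.
move=> t1 r2; rewrite decayingE //; set u := t ^+ 2.
have u1 : 1 < u by rewrite /u; nra.
have uV : u^-1 < 1 by rewrite invf_lt1; lra.
have rR : 2 <= r%:R :> R by rewrite (ler_nat _ 2).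
by rewrite divr_gt0; nra.
Qed.

Lemma growing_ge0 (R : realFieldType) r (t : R) : 1 < t ->
  r%:R * (t ^+ 2 + 1) <= (t ^+ 2) ^+ 2 + t ^+ 2 + 1 -> 0 <= growing r t.
Proof.
move=> t1; rewrite growingE //; set u := t ^+ 2 => H.
have u1 : 1 < u by rewrite /u; nra.
by rewrite divr_ge0; lra.
Qed.

(** With [u = t^2], the bound for [r.+1] gives [r (u + 1) <= u^2] and leaves at least [u + 1] in the
    numerator of [growing]. Since [r1.+1 <= r2], it applies at [v1] under the bound for [r2]. *)
Lemma growing_ge_decaying (R : realFieldType) r (t : R) : 1 < t -> (2 <= r)%N ->
  r.+1%:R * (t ^+ 2 + 1) <= (t ^+ 2) ^+ 2 + t ^+ 2 + 1 ->
  decaying r t <= t ^+ 2 * growing r t.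
Proof.
move=> t1 r2; rewrite growingE // decayingE //; set u := t ^+ 2 => H.
have u1 : 1 < u by rewrite /u; nra.
have uV : u^-1 > 0 by rewrite invr_gt0; lra.
rewrite mulrA ler_pM2r ?invr_gt0 ?subr_gt0 //.
rewrite -natr1 in H; set rr := r%:R in H *.
have := ler_wpM2r (_ : 0 <= u + 1) H.
have -> : 0 <= u + 1 by lra.
by move=> /(_ isT); nra.
Qed.

(* Used with [u = t^2] (not the vertex); [p / q] and [p' / q'] are the ratios of
   the growing to the decaying part of [A q1.-1] and [C q2] respectively. *)
Lemma localization_core (R : realFieldType) (p q p' q' u : R) :
  0 < q -> 0 < q' -> 2 < u -> 2 * u + 2 <= u ^+ 2 -> u * q <= p -> 0 <= p' ->
  (p' * (u - 1) + q' * (1 - u^-1)) * p < (p + q) * (p' + q') ->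
  p' * q < p * q'.
Proof.
move=> q0 q'0 u2 uu pq p'0 H; rewrite ltNge; apply/negP => pq'.
have u0 : u != 0 by apply: lt0r_neq0; lra.
have p0 : 0 < p by apply: lt_le_trans pq; apply: mulr_gt0; lra.
have uV : 0 < u^-1 < 2^-1 by rewrite invr_gt0 ltf_pV2 ?posrE; lra.
(* The hypothesis rearranges to [p' (p (u - 2) - q) < q' (q + p / u)]; a nonnegative factor of [p']
   lets [p q' <= p' q] be substituted. *)
have cpos : 0 <= p * (u - 2) - q.
  have : 0 <= (p - u * q) * (u - 2) by apply: mulr_ge0; lra.
  have : 0 <= q * (u ^+ 2 - (2 * u + 2)) by apply: mulr_ge0; lra.
  by nra.
have := ler_wpM2r cpos pq'.
have : q * ((p' * (u - 1) + q' * (1 - u^-1)) * p) < q * ((p + q) * (p' + q')).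
  by rewrite ltr_pM2l.
move=> H1 H2.
have H3 : q' * (p * (p * (u - 2) - q)) < q' * (p * q * u^-1 + q ^+ 2) by nra.
move: H3; rewrite ltr_pM2l // => H3.
(* The left side of [H3] is now at least [p q], while its right side is below
   [p q / 2 + p q / 2]. *)
have H4 : 2 * (p * q) <= p * (p * (u - 2)).
  have : 0 <= p * ((p - u * q) * (u - 2)) by rewrite !mulr_ge0 //; lra.
  have : 0 <= p * q * (u ^+ 2 - (2 * u + 2)) by rewrite !mulr_ge0 //; lra.
  by nra.
have H5 : u * q ^+ 2 <= p * q by have := ler_wpM2r (ltW q0) pq; nra.
have H6 : 2 * q ^+ 2 < u * q ^+ 2 by rewrite ltr_pM2r // exprn_gt0.
have H7 : p * q * u^-1 < p * q * 2^-1 by rewrite ltr_pM2l ?mulr_gt0 //; case/andP: uV.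
by lra.
Qed.

Lemma broom_bound_sqr_ge (R : realFieldType) r (u : R) : 1 < u -> (3 <= r)%N ->
  r%:R * (u + 1) <= u ^+ 2 + u + 1 -> 2 < u /\ 2 * u + 2 <= u ^+ 2.
Proof.
move=> u1 r3 H; have rR : 3 <= r%:R :> R by rewrite (ler_nat _ 3).
have : 0 <= (r%:R - 3) * (u + 1) by apply: mulr_ge0; lra.
by split; nra.
Qed.

(** * The sign of the pivot at [u] *)

(** Used with [a = q1.-1] and [c = q2]: the hypothesis concerns the pivot of [T'] at [u], the
    conclusion that of [T]. *)
Lemma shift_at_root (R : realFieldType) (r1 r2 a c : nat) (t f : R) :
  1 < t -> (2 <= r1)%N -> (r1 < r2)%N -> (2 <= a)%N -> (0 < c)%N -> 0 < f < t^-1 ->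
  r2%:R * (t ^+ 2 + 1) <= (t ^+ 2) ^+ 2 + t ^+ 2 + 1 ->
  let A := branch r1 t in let C := branch r2 t in let x := t + t^-1 in
  x - f - A a.-1 / A a - C c / C c.+1 = 0 ->
  x - f - A a / A a.+1 - C c.-1 / C c < 0.
Proof.
case: a => [|a] //; case: c => [|c] // t1 r1_ge2 r12 a2 _ /andP[f0 ft] H A C x /= root0.
have r2_ge3 : (3 <= r2)%N by apply: leq_ltn_trans r12.
have a_ge : (2 + 2 <= a.+1 * 2)%N by rewrite (@leq_mul2r 2 2 a.+1).
have t0 : 0 < t by lra.
have tN0 : t != 0 by apply: lt0r_neq0.
have u1 : 1 < t ^+ 2 by nra.
have [u2 uu] := @broom_bound_sqr_ge R r2 (t ^+ 2) u1 r2_ge3 H.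
have H1 : r1.+1%:R * (t ^+ 2 + 1) <= (t ^+ 2) ^+ 2 + t ^+ 2 + 1.
  by apply: le_trans H; rewrite ler_pM2r ?ler_nat //; lra.
have Q0 : 0 < decaying r1 t by apply: decaying_gt0.
have Q'0 : 0 < decaying r2 t by apply: decaying_gt0; rewrite // (leq_trans r1_ge2) // ltnW.
have PQ := @growing_ge_decaying R r1 t t1 r1_ge2 H1.
have P'0 := @growing_ge0 R r2 t t1 H.
have P0 : 0 <= growing r1 t by rewrite -(@pmulr_rge0 _ (t ^+ 2)); lra.
have Apos k : 0 < A k by apply: exp_pair_gt0.
have Cpos k : 0 < C k by apply: exp_pair_gt0.
have Arec : A a.+2 = x * A a.+1 - A a by apply: exp_pair_linrec.
have Crec : C c.+2 = x * C c.+1 - C c by apply: exp_pair_linrec.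
have X0 : 0 < t ^+ a.+1 by rewrite exprn_gt0.
have Y0 : 0 < t ^+ c.+1 by rewrite exprn_gt0.
have XN0 := lt0r_neq0 X0; have YN0 := lt0r_neq0 Y0.
pose p := growing r1 t * (t ^+ a.+1) ^+ 2; pose p' := growing r2 t * (t ^+ c.+1) ^+ 2.
have root1 : (x - f) * (A a.+1 * C c.+2) = A a * C c.+2 + C c.+1 * A a.+1.
  have -> : x - f = A a / A a.+1 + C c.+1 / C c.+2 by lra.
  by field; rewrite !lt0r_neq0.
(* The bound [f < 1/t] makes [x - f] exceed [t] in [root1]. *)
have lt1 : C c.+2 * (t * A a.+1 - A a) < A a.+1 * C c.+1.
  have : 0 < (t^-1 - f) * (A a.+1 * C c.+2) by rewrite mulr_gt0 ?mulr_gt0 // subr_gt0.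
  by move: root1; rewrite /x; lra.
have core : p' * decaying r1 t < p * decaying r2 t.
  apply: (@localization_core R p (decaying r1 t) p' (decaying r2 t) (t ^+ 2)) => //.
  (* Here [a.+1 >= 2], that is [q1 >= 3], gives [t^(2(a+1)) >= t^4]: one factor [t^2] is spent on
     [PQ], the other is the required [u]. *)
  - apply: le_trans (_ : t ^+ 2 * (t ^+ 2 * growing r1 t) <= _).
      by rewrite ler_pM2l // exprn_gt0.
    rewrite mulrA mulrC; apply: ler_wpM2l => //.
    by rewrite -exprD -exprM; exact: (ler_weXn2l (ltW t1) a_ge).
  - by rewrite mulr_ge0 // exprn_ge0 // ltW.
  (* The decaying part of [A] cancels in [t * A a.+1 - A a]. *)
  - have -> : (p' * (t ^+ 2 - 1) + decaying r2 t * (1 - (t ^+ 2)^-1)) * p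
        = (C c.+2 * (t * A a.+1 - A a)) * (t ^+ a.+1 * t ^+ c.+1).
      rewrite /p /p' /A /C /branch /exp_pair [t ^+ c.+2]exprS.
      have -> : t ^+ a = t ^+ a.+1 / t by rewrite exprS; field.
      by field; rewrite tN0 XN0 YN0.
    have -> : (p + decaying r1 t) * (p' + decaying r2 t)
        = (A a.+1 * C c.+1) * (t ^+ a.+1 * t ^+ c.+1).
      by rewrite /p /p' /A /C /branch /exp_pair; field; rewrite XN0 YN0.
    by rewrite ltr_pM2r // mulr_gt0.
(* Only the products of a growing with a decaying part survive in this determinant. *)
have Delta : 0 < A a.+2 * C c.+1 - A a.+1 * C c.+2.
  have -> : A a.+2 * C c.+1 - A a.+1 * C c.+2
     = (t - t^-1) / (t ^+ a.+1 * t ^+ c.+1)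
       * (p * decaying r2 t - p' * decaying r1 t).
    rewrite /p /p' /A /C /branch /exp_pair [t ^+ c.+2]exprS [t ^+ a.+2]exprS.
    by field; rewrite tN0 XN0 YN0.
  rewrite mulr_gt0 ?subr_gt0 // divr_gt0 ?mulr_gt0 // subr_gt0.
  by apply: lt_trans (t1); rewrite invf_lt1.
(* The recurrences bring both fractions to the indices of [root1]; after elimination only terms in
   [f] remain. *)
have -> : x - f - A a.+1 / A a.+2 - C c / C c.+1
    = - f * (A a.+2 * C c.+1 - A a.+1 * C c.+2) / (A a.+2 * C c.+1).
  apply: (mulIf (lt0r_neq0 (mulr_gt0 (Apos a.+2) (Cpos c.+1)))).
  rewrite divfK ?lt0r_neq0 ?mulr_gt0 //.
  transitivity ((x - f) * (A a.+2 * C c.+1) - A a.+1 * C c.+1 - C c * A a.+2).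
    by field; rewrite !lt0r_neq0.
  have := root1; rewrite Arec Crec; lra.
by rewrite mulNr mulNr oppr_lt0 divr_gt0 ?mulr_gt0.
Qed.

(* At the spectral radius [t + 1/t] of the infinite broom around [v2], the
   sequence [branch r2 t] decays exactly like [t^-k]. *)
Lemma lt0_at_broom (R : realFieldType) (r1 r2 a c : nat) (t f : R) :
  1 < t -> (2 <= r1)%N -> (r1 < r2)%N -> (0 < a)%N -> 0 < f ->
  r2%:R * (t ^+ 2 + 1) = (t ^+ 2) ^+ 2 + t ^+ 2 + 1 ->
  t + t^-1 - f - branch r1 t a.-1 / branch r1 t a
    - branch r2 t c / branch r2 t c.+1 < 0.
Proof.
case: a => [|a] // t1 r1_ge2 r12 _ f0 H.
set A := branch r1 t; set C := branch r2 t.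

have t0 : 0 < t by lra.
have tN0 : t != 0 by apply: lt0r_neq0.
have P'0 : growing r2 t = 0 by rewrite growingE // H subrr mul0r.
have Q'0 : 0 < decaying r2 t by apply: decaying_gt0; rewrite // (leq_trans r1_ge2) // ltnW.
have Q0 : 0 < decaying r1 t by apply: decaying_gt0.
have P0 : 0 <= growing r1 t.
  apply: growing_ge0 => //; rewrite -H ler_wpM2r ?ler_nat ?(ltnW r12) //.
  by rewrite addr_ge0 ?exprn_ge0 // ltW.
have Apos k : 0 < A k by apply: exp_pair_gt0.
have tk k : 0 < t ^+ k by rewrite exprn_gt0.
have -> : C c / C c.+1 = t.
  by rewrite /C /branch /exp_pair P'0 exprS; field; rewrite !lt0r_neq0.
(* The two branches then contribute more than [t + 1/t], so the pivot is below [-f]. *)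
have ratio : t^-1 < A a / A a.+1.
  rewrite ltr_pdivlMr // -subr_gt0.
  have -> : A a - t^-1 * A a.+1 = decaying r1 t * (1 - (t ^+ 2)^-1) / t ^+ a.
    by rewrite /A /branch /exp_pair exprS; field; rewrite !lt0r_neq0.
  rewrite divr_gt0 // mulr_gt0 // subr_gt0 invf_lt1 ?exprn_gt0 //; nra.
by lra.
Qed.

(** * The parameter [t] and the comparison of the two trees *)

Lemma broom_param (R : rcfType) r : (3 <= r)%N ->
  exists2 t : R, 1 < t & r%:R * (t ^+ 2 + 1) = (t ^+ 2) ^+ 2 + t ^+ 2 + 1.
Proof.
move=> r3; have rR : 3 <= r%:R :> R by rewrite (ler_nat _ 3).
(* In [u = t^2] the equation reads [u^2 - m u - m = 0]; its positive root is taken. *)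
pose m : R := r%:R - 1; pose s := Num.sqrt (m ^+ 2 + 4 * m).
have m2 : 2 <= m by rewrite /m; lra.
have sE : s ^+ 2 = m ^+ 2 + 4 * m by rewrite sqr_sqrtr //; nra.
have s0 : 0 <= s by apply: sqrtr_ge0.
pose u := (m + s) / 2.
have u1 : 1 < u by rewrite /u; nra.
have tE : Num.sqrt u ^+ 2 = u by rewrite sqr_sqrtr //; lra.
exists (Num.sqrt u); first by rewrite -sqrtr1 ltr_sqrt; lra.
rewrite tE; have -> : r%:R = m + 1 by rewrite /m; ring.
by rewrite /u; nra.
Qed.

(** The quotient [(u^2 + u + 1) / (u + 1) = u + 1 / (u + 1)] increases with [u = t^2 > 1]. *)
Lemma broom_bound_mono (R : realFieldType) (r : nat) (t0 t : R) :
  1 < t0 -> t0 <= t ->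
  r%:R * (t0 ^+ 2 + 1) <= (t0 ^+ 2) ^+ 2 + t0 ^+ 2 + 1 ->
  r%:R * (t ^+ 2 + 1) <= (t ^+ 2) ^+ 2 + t ^+ 2 + 1.
Proof.
move=> t01 tt0.
have u0 : 1 < t0 ^+ 2 by nra.
have uu0 : t0 ^+ 2 <= t ^+ 2 by nra.
move: (t0 ^+ 2) (t ^+ 2) u0 uu0 => u v u1 uv H.
rewrite -(@ler_pM2r _ (u + 1)); last by lra.
have : r%:R * (u + 1) * (v + 1) <= (u ^+ 2 + u + 1) * (v + 1).
  by rewrite ler_pM2r; lra.
have : 0 <= (v - u) * (u * v + u + v) by rewrite mulr_ge0; nra.
by lra.
Qed.

Lemma add_inv_param (R : rcfType) (t0 x : R) : 1 < t0 -> t0 + t0^-1 < x ->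
  exists2 t, t0 < t & x = t + t^-1.
Proof.
move=> t01 H; pose s := Num.sqrt (x ^+ 2 - 4).
have t0V : t0 * t0^-1 = 1 by rewrite divff // lt0r_neq0 //; lra.
have V0 : 0 < t0^-1 by rewrite invr_gt0; lra.
have x2 : 2 < x by nra.
have sE : s ^+ 2 = x ^+ 2 - 4 by rewrite sqr_sqrtr //; nra.
have s0 : 0 <= s by apply: sqrtr_ge0.
pose t := (x + s) / 2.
have tx : t * (x - t) = 1 by rewrite /t; nra.
have t0' : t != 0 by apply: lt0r_neq0; rewrite /t; lra.
have tVE : t^-1 = x - t by apply: (mulfI t0'); rewrite divff.
exists t; last by rewrite tVE; ring.
(* The polynomial [z^2 - x z + 1] has roots [t] and [x - t] and is negative at [t0], so [t0] lies
   strictly between them. *)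
have : (t0 - t) * (t0 - (x - t)) < 0.
  have -> : (t0 - t) * (t0 - (x - t)) = t0 * (t0 + t0^-1 - x) + (t * (x - t) - t0 * t0^-1) by ring.
  by rewrite tx t0V subrr addr0 nmulr_llt0 //; lra.
rewrite /t; nra.
Qed.

Lemma char_poly_tree_param (R : realFieldType) (r1 r2 h q1 q2 : nat) (t : R) :
  1 < t -> (2 <= r1)%N -> (r1 < r2)%N -> (0 < h)%N -> (0 < q1)%N -> (0 < q2)%N ->
  r2%:R * (t ^+ 2 + 1) <= (t ^+ 2) ^+ 2 + t ^+ 2 + 1 ->
  exists2 c, 0 < c &
    (char_poly (tree_adj R (tree_order r1 r2 h q1 q2) r1 r2 h q1 q2)).[t + t^-1]
    = c * (t + t^-1 - exp_pair 1 (-1) t h / exp_pair 1 (-1) t h.+1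
           - branch r1 t q1.-1 / branch r1 t q1
           - branch r2 t q2.-1 / branch r2 t q2).
Proof.
move=> t1 r1_ge2 r12 h0 q10 q20 H.
have t0 : 0 < t by lra.
have tN0 : t != 0 by apply: lt0r_neq0.
have H1 : r1%:R * (t ^+ 2 + 1) <= (t ^+ 2) ^+ 2 + t ^+ 2 + 1.
  apply: le_trans H; rewrite ler_wpM2r ?ler_nat ?(ltnW r12) //.
  by rewrite addr_ge0 ?exprn_ge0 // ltW.
apply: char_poly_tree; rewrite ?branch0 ?branch1 //; try exact: exp_pair_linrec.
- have : t * t^-1 = 1 by rewrite divff.
  by have : 0 < t^-1 by [rewrite invr_gt0]; nra.
- by rewrite /exp_pair !expr0; field.
- by move=> k; apply: pendant_gt0.
- by move=> k; apply: exp_pair_gt0 => //; [apply: growing_ge0|apply: decaying_gt0].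
- move=> k; apply: exp_pair_gt0 => //; [exact: growing_ge0|apply: decaying_gt0 => //].
  by rewrite (leq_trans r1_ge2) // ltnW.
Qed.

Theorem theorem4p2 (R : rcfType) (r1 r2 h q1 q2 n : nat) :
  (2 <= r1)%N -> (r1 < r2)%N ->
  (2 <= h)%N -> (3 <= q1)%N -> (2 <= q2)%N ->
  n = tree_order r1 r2 h q1 q2 ->
  spectral_radius (tree_adj R n r1 r2 h q1.-1 q2.+1)
    < spectral_radius (tree_adj R n r1 r2 h q1 q2).
Proof.
move=> r1_ge2 r12 h2 q13 q22 nE.
have r2_ge3 : (3 <= r2)%N by apply: leq_ltn_trans r12.
have h0 : (0 < h)%N by apply: ltn_trans h2.
have q20 : (0 < q2)%N by apply: ltn_trans q22.
have q10 : (0 < q1)%N by apply: leq_trans q13.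
have q1'2 : (2 <= q1.-1)%N by rewrite -ltnS prednK.
have q1'0 : (0 < q1.-1)%N by apply: ltn_trans q1'2.
have nE' : n = tree_order r1 r2 h q1.-1 q2.+1 by rewrite nE /tree_order; lia.
have [t0 t01 Ht0] := @broom_param R r2 r2_ge3.
have Ht0' : r2%:R * (t0 ^+ 2 + 1) <= (t0 ^+ 2) ^+ 2 + t0 ^+ 2 + 1 by rewrite Ht0.
have f_bounds t := @pendant_ratio R t h ^~ h0.
set rho' := spectral_radius (tree_adj R n r1 r2 h q1.-1 q2.+1).
have lt_rho' : t0 + t0^-1 < rho'.
  apply: lt_spectral_radius; rewrite nE'.
  have [c c0 ->] := @char_poly_tree_param R r1 r2 h q1.-1 q2.+1 t0 t01
    r1_ge2 r12 h0 q1'0 isT Ht0'.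
  rewrite pmulr_rlt0 //; apply: lt0_at_broom => //.
  by have /andP[] := f_bounds t0 t01.
have t0_gt0 : 0 < t0 by apply: lt_trans t01.
have rho'_gt0 : 0 < rho' by apply: lt_trans lt_rho'; rewrite addr_gt0 ?invr_gt0.
have [t tt0 rho'E] := @add_inv_param R t0 rho' t01 lt_rho'.
have t1 : 1 < t by apply: lt_trans tt0.
have Ht := @broom_bound_mono R r2 t0 t t01 (ltW tt0) Ht0'.
have := root_spectral_radius _ _ _ rho'_gt0; rewrite -/rho' rho'E nE'.
have [c c0 ->] := @char_poly_tree_param R r1 r2 h q1.-1 q2.+1 t t1
    r1_ge2 r12 h0 q1'0 isT Ht.
(* As [c > 0], the vanishing of the characteristic polynomial at [rho'] passes to the pivot of [T']
   at [u]. *)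
move/eqP; rewrite mulf_eq0 gt_eqF //= => /eqP root0.
apply: lt_spectral_radius; rewrite -nE' nE.
have [c' c'0 ->] := @char_poly_tree_param R r1 r2 h q1 q2 t t1
    r1_ge2 r12 h0 q10 q20 Ht.
rewrite pmulr_rlt0 //.
have := @shift_at_root R r1 r2 q1.-1 q2 t _ t1 r1_ge2 r12 q1'2 q20 (f_bounds t t1) Ht root0.
by rewrite prednK.
Qed.
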